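(* Consider the $\beta$-biased exclusion process on $\{1,\ldots,n\}$ with $k$ particles, where $\beta=\beta_n>0$ and $k=k_n$ satisfies $k/n\to\rho\le1/2$, and let $t_{\rm mix}(\varepsilon)$ be its mixing time. If $n\beta\to\infty$ but $n\beta\le\log n$, then (as $n\to\infty$, for $\varepsilon\in(0,1)$) $$t_{\rm mix}(\varepsilon)\ \ge\ \frac{n}{\beta^2}\,[1+o(1)]\,\Bigl(\log n+\log\bigl[(1-\varepsilon)/\varepsilon\bigr]\Bigr).$$
   Context: The $\beta$-biased exclusion process on $\{1,\ldots,n\}$ with $k$ particles is the discrete-time Markov chain on the set of configurations $\sigma\in\{0,1\}^n$ with exactly $k$ ones (particles), with the following transitions. At each step choose one of the $n-1$ edges $\{i,i+1\}$ of the path uniformly at random. If both endpoints are occupied or both are vacant, do nothing. If exactly one endpoint is occupied, place the particle on the right vertex $i+1$ with probability $p=(1+\beta)/2$ and on the left vertex $i$ with probability $q=(1-\beta)/2$. This chain is reversible and ergodic with a unique stationary distribution $\pi$. The mixing time is $$t_{\rm mix}(\varepsilon)=\min\{t\ge 0:\ \max_{\sigma}\|\mathbf P_\sigma(X_t\in\cdot)-\pi\|_{\rm TV}<\varepsilon\}.$$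
   Formalization: The limiting density is assumed positive, 0 < ρ ≤ 1/2; with ρ = 0 the claim fails, e.g. k = 0 gives mixing time 0, and k = 1 with nβ = log log n gives mixing time of order n²/β. *)

(* Defs.v *)
From HB Require Import structures.
From mathcomp Require Import all_boot all_order all_algebra.
From mathcomp Require Import all_classical all_reals all_analysis.

Set Implicit Arguments.
Unset Strict Implicit.
Unset Printing Implicit Defensive.

Import Order.TTheory GRing.Theory Num.Theory.
Import numFieldNormedType.Exports.
Local Open Scope ring_scope.

(* Finite Markov chains; [P x y] is the probability of a step from x to y. *)

Definition chain_step (R : realType) (T : finType) (P : T -> T -> R)
    (mu : T -> R) : T -> R :=
  fun y => \sum_(x : T) mu x * P x y.

Definition chain_law (R : realType) (T : finType) (P : T -> T -> R)
    (x : T) (t : nat) : T -> R :=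
  iter t (chain_step P) (fun y => (y == x)%:R).

Definition is_distribution (R : realType) (T : finType) (mu : T -> R) : Prop :=
  (forall x, 0 <= mu x) /\ \sum_(x : T) mu x = 1.

Definition is_stationary (R : realType) (T : finType) (P : T -> T -> R)
    (mu : T -> R) : Prop :=
  is_distribution mu /\ chain_step P mu =1 mu.

(* The maximum over events A of |mu(A) - nu(A)|; all the terms are
   nonnegative, so 0 is a neutral initial value (also in [max_tv_dist]). *)
Definition tv_dist (R : realType) (T : finType) (mu nu : T -> R) : R :=
  \big[Num.max/0]_(A : {set T})
    `| \sum_(x in A) mu x - \sum_(x in A) nu x |.

Definition max_tv_dist (R : realType) (T : finType) (P : T -> T -> R)
    (mu : T -> R) (t : nat) : R :=
  \big[Num.max/0]_(x : T) tv_dist (chain_law P x t) mu.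

(* The minimum of an empty set of times is +oo; this case does not arise for
   an ergodic chain with stationary distribution mu and eps > 0. *)
Definition mixing_time (R : realType) (T : finType) (P : T -> T -> R)
    (mu : T -> R) (eps : R) : \bar R :=
  if pselect (exists t : nat, max_tv_dist P mu t < eps) is left ex_t
  then ((ex_minn ex_t)%:R)%:E else +oo%E.

(* The vertices 1, ..., n of the path are the elements 0, ..., n - 1 of 'I_n,
   and the edge indexed by i : 'I_n.-1 joins the vertices i and i + 1. *)

Definition edge_left (n : nat) (i : 'I_n.-1) : 'I_n :=
  widen_ord (leq_pred n) i.

Lemma edge_right_subproof (n : nat) (i : 'I_n.-1) : (i.+1 < n)%N.
Proof. by rewrite -ltn_predRL ltn_ord. Qed.

Definition edge_right (n : nat) (i : 'I_n.-1) : 'I_n :=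
  Ordinal (edge_right_subproof i).

Record config (n k : nat) : Type := Config {
  occupied :> {ffun 'I_n -> bool};
  _ : #|[set v | occupied v]| == k }.

HB.instance Definition _ (n k : nat) := [isSub for @occupied n k].
HB.instance Definition _ (n k : nat) := [Finite of config n k by <:].

(* sigma with one particle on the edge i, at its right end if [right] is true
   and at its left end otherwise. *)
Definition place (n : nat) (sigma : {ffun 'I_n -> bool}) (i : 'I_n.-1)
    (right : bool) : {ffun 'I_n -> bool} :=
  [ffun v => if v == edge_left i then ~~ right
             else if v == edge_right i then right
             else sigma v].

Definition edge_update (R : realType) (beta : R) (n k : nat) (i : 'I_n.-1)
    (sigma tau : config n k) : R :=
  if sigma (edge_left i) == sigma (edge_right i)
  then (tau == sigma)%:R
  else (1 + beta) / 2 * (val tau == place sigma i true)%:R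
     + (1 - beta) / 2 * (val tau == place sigma i false)%:R.

Definition biased_exclusion (R : realType) (beta : R) (n k : nat)
    (sigma tau : config n k) : R :=
  (n.-1%:R)^-1 * \sum_(i < n.-1) edge_update beta i sigma tau.

(* Main.v *)
Require Import Defs.
From mathcomp Require Import all_boot all_order all_algebra.
From mathcomp Require Import all_classical all_reals all_analysis.
From mathcomp Require Import ring lra.
Import Order.TTheory GRing.Theory Num.Theory.
Import numFieldNormedType.Exports.
Local Open Scope classical_set_scope.
Local Open Scope ring_scope.

(* Wilson's method. The Cole-Hopf transform theta^(N_x), with N_x the number of
   particles in the first x sites and theta = p/q, is linear under the dynamics:
   updating the edge {x, x+1} replaces it on average by
   p theta^(N_(x-1)) + q theta^(N_(x+1)). Subtract its stationary profile and sum
   against theta^(-x/2) sin(pi x/n): the result is an eigenfunction with rate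
   gap = (1 - sqrt(1-beta^2) cos(pi/n)) / (n-1) ~ beta^2/(2n).
   One step changes it by at most about beta theta^(k/2), while started from all
   particles on the left it is of order theta^(k/2)/beta. Since its mean decays
   like (1-gap)^t, it separates the law at time t from the stationary law as long
   as (1-gap)^(2t) >> n beta^2, that is for
   t <= (n/beta^2) (log n - 2 log(n beta) - O(1)); the correction is
   negligible because n beta <= log n. *)

(** * Finite Markov chains and Wilson's second-moment bound *)

Lemma sum_chain_step (R : realType) (T : finType) (P : T -> T -> R)
    (nu f : T -> R) :
  \sum_y chain_step P nu y * f y = \sum_x nu x * \sum_y P x y * f y.
Proof.
under eq_bigr do rewrite mulr_suml.
rewrite exchange_big; apply: eq_bigr => x _ /=.
by rewrite mulr_sumr; apply: eq_bigr => y _; rewrite mulrA.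
Qed.

Lemma chain_law_distribution (R : realType) (T : finType) (P : T -> T -> R)
    (x : T) (t : nat) :
  (forall y, is_distribution (P y)) -> is_distribution (chain_law P x t).
Proof.
move=> Pdist; elim: t => [|t [law_ge0 law_sum1]].
  split=> [y|]; first by rewrite ler0n.
  by rewrite (bigD1 x)//= eqxx big1 ?addr0// => y /negbTE ->.
split=> [y|]; first by apply: sumr_ge0 => z _; rewrite mulr_ge0// (Pdist z).1.
transitivity (\sum_y chain_law P x t.+1 y * 1).
  by under [RHS]eq_bigr do rewrite mulr1.
rewrite sum_chain_step -[RHS]law_sum1; apply: eq_bigr => z _.
by under eq_bigr do rewrite mulr1; rewrite (Pdist z).2 mulr1.
Qed.

Lemma mean_step (R : realType) (T : finType) (P : T -> T -> R) (f : T -> R)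
    (gam : R) (x : T) :
  is_distribution (P x) ->
  \sum_y P x y * (f y - f x) = - gam * f x ->
  \sum_y P x y * f y = (1 - gam) * f x.
Proof.
move=> [_ P1] drift.
transitivity (\sum_y P x y * (f y - f x) + (\sum_y P x y) * f x).
  by rewrite mulr_suml -big_split; apply: eq_bigr => y _ /=; ring.
by rewrite drift P1; ring.
Qed.

Lemma second_moment_step (R : realType) (T : finType) (P : T -> T -> R)
    (f : T -> R) (gam v : R) (x : T) :
  is_distribution (P x) ->
  \sum_y P x y * (f y - f x) = - gam * f x ->
  \sum_y P x y * (f y - f x) ^+ 2 <= v ->
  \sum_y P x y * f y ^+ 2 <= (1 - 2 * gam) * f x ^+ 2 + v.
Proof.
move=> [_ P1] drift var.
have -> : \sum_y P x y * f y ^+ 2 = \sum_y P x y * (f y - f x) ^+ 2 +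
    (2 * f x) * (\sum_y P x y * (f y - f x)) + (\sum_y P x y) * f x ^+ 2.
  rewrite mulr_suml mulr_sumr -!big_split; apply: eq_bigr => y _ /=; ring.
rewrite drift P1; nra.
Qed.

Lemma markov_fin (R : realType) (T : finType) (nu g : T -> R) (A : {set T})
    (a : R) :
  (forall x, 0 <= nu x) -> (forall x, 0 <= g x) ->
  (forall x, x \in A -> a <= g x) ->
  a * \sum_(x in A) nu x <= \sum_x nu x * g x.
Proof.
move=> nu0 g0 Ag.
rewrite mulr_sumr [leRHS](bigID (mem A)) /= ler_wpDr//.
  by apply: sumr_ge0 => x _; rewrite mulr_ge0.
by apply: ler_sum => x xA; rewrite mulrC ler_wpM2l ?Ag.
Qed.

Lemma ge_tv_dist (R : realType) (T : finType) (mu nu : T -> R) (A : {set T}) :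
  \sum_(x in A) mu x - \sum_(x in A) nu x <= tv_dist mu nu.
Proof.
apply: le_trans (ler_norm _) _.
exact: (le_bigmax _ (fun A : {set T} =>
  `|\sum_(x in A) mu x - \sum_(x in A) nu x|)).
Qed.

Lemma max_tv_dist_ge (R : realType) (T : finType) (P : T -> T -> R)
    (mu : T -> R) (x : T) (t : nat) :
  tv_dist (chain_law P x t) mu <= max_tv_dist P mu t.
Proof. exact: (le_bigmax _ (fun x => tv_dist (chain_law P x t) mu)). Qed.

(** Under the law at time [t], [f] has mean [D] and variance at most [V]; under [mu] its second
    moment is at most [V]. Chebyshev at the midpoint [D / 2] costs [4 * V / D ^+ 2] on each side, so
    the distance is at least [1 - 8 * V / D ^+ 2]. *)
Lemma wilson (R : realType) (T : finType) (P : T -> T -> R) (mu f : T -> R)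
    (gam v eps : R) (x : T) (t : nat) :
  (forall y, is_distribution (P y)) -> is_stationary P mu ->
  (forall y, \sum_z P y z * (f z - f y) = - gam * f y) ->
  (forall y, \sum_z P y z * (f z - f y) ^+ 2 <= v) ->
  0 < gam -> gam <= 1 / 2 -> 0 < f x ->
  max_tv_dist P mu t < eps ->
  (1 - eps) * ((1 - gam) ^+ t * f x) ^+ 2 <= 4 * v / gam.
Proof.
move=> Pdist [[mu_ge0 mu_sum1] mu_stat] drift var gam_gt0 gam_le fx_gt0 tv_lt.
set nu := chain_law P x t; set D := _ * f x.
(* The fixed point of the second-moment recursion [S -> (1 - 2 * gam) * S + v], which also bounds
   the stationary second moment. *)
pose V := v / (2 * gam).
have gamV : 2 * gam * V = v by rewrite /V; field; lra.
have [nu_ge0 nu_sum1] : is_distribution nu by exact: chain_law_distribution.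
have nu_mean : \sum_y nu y * f y = D.
  rewrite /nu /D; elim: t {tv_lt nu D nu_ge0 nu_sum1} => [|t IH].
    rewrite (bigD1 x)//= eqxx big1 ?addr0 ?mul1r// => y /negbTE ->.
    by rewrite mul0r.
  rewrite /= sum_chain_step exprS -mulrA -IH mulr_sumr; apply: eq_bigr => y _.
  by rewrite (mean_step _ _ _ _ gam)//; ring.
have D_gt0 : 0 < D by rewrite mulr_gt0// exprn_gt0//; lra.
have v_ge0 : 0 <= v.
  by apply: le_trans (var x); apply: sumr_ge0 => y _;
     rewrite mulr_ge0 ?sqr_ge0// (Pdist x).1.
have nu_second : \sum_y nu y * f y ^+ 2 <= D ^+ 2 + V.
  rewrite /nu /D; elim: t {tv_lt nu D nu_ge0 nu_sum1 nu_mean D_gt0} => [|t IH].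
    rewrite (bigD1 x)//= eqxx big1 ?addr0 ?mul1r => [|y /negbTE ->].
      by rewrite ler_wpDr// divr_ge0//; lra.
    by rewrite mul0r.
  rewrite /= sum_chain_step.
  have [law_ge0 law_sum1] := chain_law_distribution _ _ P x t Pdist.
  apply: (@le_trans _ _
    (\sum_y chain_law P x t y * ((1 - 2 * gam) * f y ^+ 2 + v))).
    by apply: ler_sum => y _; rewrite ler_wpM2l// second_moment_step.
  have -> : \sum_y chain_law P x t y * ((1 - 2 * gam) * f y ^+ 2 + v) =
    (1 - 2 * gam) * (\sum_y chain_law P x t y * f y ^+ 2) +
      (\sum_y chain_law P x t y) * v.
    by rewrite mulr_sumr mulr_suml -big_split; apply: eq_bigr => y _ /=; ring.
  rewrite law_sum1 mul1r (exprS _ t).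
  move: IH; set S := \sum_y _; set L := (1 - gam) ^+ t * f x => IH.
  have -> : (1 - gam) * (1 - gam) ^+ t * f x = (1 - gam) * L by rewrite mulrA.
  have SL : (1 - 2 * gam) * S <= (1 - 2 * gam) * (L ^+ 2 + V).
    by rewrite ler_wpM2l//; lra.
  (* [1 - 2 * gam] is [(1 - gam) ^+ 2] minus [gam ^+ 2]; the slack is exactly [(gam * L) ^+ 2]. *)
  by have := sqr_ge0 (gam * L); nra.
have nu_var : \sum_y nu y * (f y - D) ^+ 2 <= V.
  have -> : \sum_y nu y * (f y - D) ^+ 2 = \sum_y nu y * f y ^+ 2
      - 2 * D * (\sum_y nu y * f y) + D ^+ 2 * \sum_y nu y.
    rewrite !mulr_sumr -sumrB -big_split; apply: eq_bigr => y _ /=; ring.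
  rewrite nu_mean nu_sum1; move: nu_second; rewrite expr2; lra.
have mu_second : \sum_y mu y * f y ^+ 2 <= V.
  have : \sum_y mu y * f y ^+ 2 <=
      (1 - 2 * gam) * (\sum_y mu y * f y ^+ 2) + v.
    have {1}-> : \sum_y mu y * f y ^+ 2 = \sum_y chain_step P mu y * f y ^+ 2.
      by apply: eq_bigr => y _; rewrite mu_stat.
    have -> : v = (\sum_y mu y) * v by rewrite mu_sum1 mul1r.
    rewrite sum_chain_step mulr_sumr mulr_suml.
    rewrite -big_split; apply: ler_sum => y _ /=.
    rewrite (_ : _ + _ = mu y * ((1 - 2 * gam) * f y ^+ 2 + v)); last by ring.
    by rewrite ler_wpM2l// second_moment_step.
  by nra.
pose A := [set y | D / 2 < f y]%SET.
have muA : (D / 2) ^+ 2 * \sum_(y in A) mu y <= V.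
  apply: le_trans mu_second; apply: markov_fin => // y; first exact: sqr_ge0.
  rewrite inE => yA; nra.
have nuA : (D / 2) ^+ 2 * \sum_(y in ~: A) nu y <= V.
  apply: le_trans nu_var; apply: markov_fin => // y; first exact: sqr_ge0.
  rewrite !inE -leNgt => yA; nra.
have tvA := le_lt_trans (le_trans (ge_tv_dist _ _ nu mu A)
  (max_tv_dist_ge _ _ P mu x t)) tv_lt.
have nuAc : \sum_(y in ~: A) nu y = 1 - \sum_(y in A) nu y.
  rewrite -nu_sum1 [in RHS](bigID (mem A)) /= addrAC subrr add0r.
  by apply: eq_bigl => y; rewrite inE.
rewrite nuAc in nuA.
have -> : 4 * v / gam = 8 * V by rewrite /V; field; lra.
have := sqr_ge0 D; nra.
Qed.

(** * Heights and their change under an edge update *)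

Definition height {n : nat} (s : {ffun 'I_n -> bool}) (x : nat) : nat :=
  (\sum_(v < n | v < x) s v)%N.

Lemma height0 (n : nat) (s : {ffun 'I_n -> bool}) : height s 0 = 0%N.
Proof. by rewrite /height big_pred0. Qed.

Lemma heightS (n : nat) (s : {ffun 'I_n -> bool}) (v : 'I_n) :
  height s v.+1 = (height s v + s v)%N.
Proof.
rewrite /height (bigD1 v)//= addnC; congr addn; apply: eq_bigl => u.
by rewrite ltnS [RHS]ltn_neqAle andbC.
Qed.

Lemma height_card (n : nat) (s : {ffun 'I_n -> bool}) :
  height s n = #|[set v | s v]%SET|.
Proof.
rewrite -sum1_card /height big_mkcond [RHS]big_mkcond /=.
by apply: eq_bigr => v _; rewrite inE ltn_ord; case: (s v).
Qed.

Lemma height_config (n k : nat) (s : config n k) : height s n = k.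
Proof. by rewrite height_card; apply/eqP; case: s. Qed.

Lemma height_le (n : nat) (s : {ffun 'I_n -> bool}) (x : nat) :
  (x <= n)%N -> (height s x <= x)%N.
Proof.
elim: x => [|x IH] xn; first by rewrite height0.
rewrite (heightS _ s (Ordinal xn)) -addn1 leq_add ?leq_b1//.
by rewrite IH// ltnW.
Qed.

Lemma height_mono (n : nat) (s : {ffun 'I_n -> bool}) (x y : nat) :
  (x <= y)%N -> (height s x <= height s y)%N.
Proof.
move=> xy; rewrite /height big_mkcond [leqRHS]big_mkcond leq_sum// => v _.
by case: ifP => // vx; rewrite (leq_trans vx xy).
Qed.

Lemma edge_left_neq_right (n : nat) (i : 'I_n.-1) :
  (edge_right i == edge_left i) = false.
Proof. by apply/negbTE; rewrite -val_eqE /= neq_ltn ltnSn orbT. Qed.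

Lemma place_left (n : nat) (s : {ffun 'I_n -> bool}) (i : 'I_n.-1) (b : bool) :
  place s i b (edge_left i) = ~~ b.
Proof. by rewrite ffunE eqxx. Qed.

Lemma place_right (n : nat) (s : {ffun 'I_n -> bool}) (i : 'I_n.-1) (b : bool) :
  place s i b (edge_right i) = b.
Proof. by rewrite ffunE edge_left_neq_right eqxx. Qed.

(** A particle moves only between the sites [i] and [i.+1], counted from 0, so among all heights
    only the one at [i.+1] can change. Hence an update alters a single summand of
    [eigenfunction]. *)
Lemma height_place_low (n : nat) (s : {ffun 'I_n -> bool}) (i : 'I_n.-1)
    (b : bool) (x : nat) :
  (x <= i)%N -> height (place s i b) x = height s x.
Proof.
move=> xi; apply: eq_bigr => v vx; rewrite ffunE -!val_eqE /=.
by rewrite !ltn_eqF// ?ltnS ?(leq_trans (ltnW vx))// (leq_trans vx).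
Qed.

Lemma height_place_mid (n : nat) (s : {ffun 'I_n -> bool}) (i : 'I_n.-1)
    (b : bool) :
  height (place s i b) i.+1 = (height s i + ~~ b)%N.
Proof.
by rewrite (heightS _ _ (edge_left i)) place_left height_place_low.
Qed.

Lemma height_edge (n : nat) (s : {ffun 'I_n -> bool}) (i : 'I_n.-1) :
  height s i.+2 = (height s i + s (edge_left i) + s (edge_right i))%N.
Proof.
by rewrite (heightS _ _ (edge_right i)) (heightS _ _ (edge_left i)).
Qed.

Lemma height_place_high (n : nat) (s : {ffun 'I_n -> bool}) (i : 'I_n.-1)
    (b : bool) (x : nat) :
  s (edge_left i) != s (edge_right i) -> (i.+1 < x)%N -> (x <= n)%N ->
  height (place s i b) x = height s x.
Proof.
move=> lr; elim: x => // x IH; rewrite ltnS leq_eqVlt => /predU1P[<-|ix] xn.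
  rewrite !height_edge place_left place_right height_place_low//.
  by move: lr {IH}; case: (s _); case: (s _); case: b; rewrite ?addn0 ?addn1.
have step u : height u x.+1 = (height u x + u (Ordinal xn))%N.
  exact: (heightS _ u (Ordinal xn)).
rewrite !step (IH ix (ltnW xn)) ffunE -!val_eqE /=.
by rewrite (gtn_eqF ix) (gtn_eqF (ltnW ix)).
Qed.

Lemma place_card (n k : nat) (s : config n k) (i : 'I_n.-1) (b : bool) :
  s (edge_left i) != s (edge_right i) ->
  #|[set v | place s i b v]%SET| == k.
Proof.
move=> lr; rewrite -height_card height_place_high ?height_config//.
exact: edge_right_subproof.
Qed.

(** * One-step averages of the exclusion process *)

(** Test functions live on all occupation functions because [place] returns one without a proof of
    its particle number; that proof is supplied here by the cardinality hypothesis. *)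
Lemma sum_config_delta (R : realType) (n k : nat) (f : {ffun 'I_n -> bool} -> R)
    (s : {ffun 'I_n -> bool}) :
  #|[set v | s v]%SET| == k ->
  \sum_(t : config n k) (val t == s)%:R * f (val t) = f s.
Proof.
move=> sk; rewrite (bigD1 (Config sk))//= eqxx mul1r big1 ?addr0// => t ts.
have /negbTE -> : val t != s by rewrite -(inj_eq val_inj) in ts.
by rewrite mul0r.
Qed.

Lemma sum_edge_update (R : realType) (beta : R) (n k : nat) (i : 'I_n.-1)
    (s : config n k) (f : {ffun 'I_n -> bool} -> R) :
  \sum_(t : config n k) edge_update beta i s t * f (val t) =
  if s (edge_left i) == s (edge_right i) then f (val s)
  else (1 + beta) / 2 * f (place s i true)
     + (1 - beta) / 2 * f (place s i false).
Proof.
rewrite /edge_update; case: ifPn => lr.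
  by apply: sum_config_delta; case: s lr.
under eq_bigr => t _ do rewrite mulrDl -!mulrA.
by rewrite big_split -!mulr_sumr !sum_config_delta ?place_card//= !mulrA.
Qed.

Lemma sum_biased_exclusion (R : realType) (beta : R) (n k : nat)
    (s : config n k) (f : {ffun 'I_n -> bool} -> R) :
  \sum_(t : config n k) biased_exclusion beta s t * f (val t) =
  (n.-1%:R)^-1 * \sum_(i < n.-1)
    \sum_(t : config n k) edge_update beta i s t * f (val t).
Proof.
under eq_bigr do rewrite /biased_exclusion -mulrA mulr_suml.
by rewrite -mulr_sumr exchange_big.
Qed.

Lemma biased_exclusion_distribution (R : realType) (beta : R) (n k : nat)
    (s : config n k) :
  (1 < n)%N -> 0 <= beta <= 1 -> is_distribution (biased_exclusion beta s).
Proof.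
move=> n1 b01; split=> [t|].
  rewrite mulr_ge0// sumr_ge0// => i _; rewrite /edge_update.
  by case: ifP => // _; rewrite addr_ge0// mulr_ge0//; lra.
transitivity (\sum_(t : config n k) biased_exclusion beta s t * 1).
  by under [RHS]eq_bigr do rewrite mulr1.
rewrite (sum_biased_exclusion _ _ _ _ _ (fun=> 1)).
under eq_bigr => i _.
  rewrite (sum_edge_update _ _ _ _ _ _ (fun=> 1)).
  rewrite (_ : (if _ then _ else _) = 1).
    over.
  by case: ifP => // _; field.
rewrite sumr_const card_ord mulVf// pnatr_eq0.
by case: n n1 s => [|[]].
Qed.

(** * The Cole-Hopf eigenfunction: drift and variance *)

Definition phi (R : realType) (w : R) (n x : nat) : R :=
  sin (x%:R * (pi / n%:R)) / w ^+ x.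

Lemma phi_0 (R : realType) (w : R) (n : nat) : phi R w n 0 = 0.
Proof. by rewrite /phi mul0r sin0 mul0r. Qed.

Lemma phi_n (R : realType) (w : R) (n : nat) : (0 < n)%N -> phi R w n n = 0.
Proof.
move=> n0; rewrite /phi mulrCA divff ?mulr1 ?sinpi ?mul0r//.
by rewrite pnatr_eq0 -lt0n.
Qed.

(** Since p = r w / 2 and q = r / (2 w), the powers of [w] symmetrise the operator and leave the
    sine addition formulas. The hypotheses force [r ^+ 2 = 1 - beta ^+ 2] and [w ^+ 2] = p/q. *)
Lemma phi_eigen (R : realType) (w r beta : R) (n x : nat) :
  0 < w -> 1 + beta = r * w -> r = w * (1 - beta) ->
  (1 + beta) / 2 * phi R w n x.+2 + (1 - beta) / 2 * phi R w n x =
  r * cos (pi / n%:R) * phi R w n x.+1.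
Proof.
move=> w0 rw wr; rewrite /phi; set h := pi / _.
have -> : x.+2%:R * h = x.+1%:R * h + h by rewrite -natr1; ring.
have -> : x%:R * h = x.+1%:R * h - h by rewrite -natr1; ring.
rewrite sinD sinB rw wr !exprS; field.
by rewrite expf_neq0 ?gt_eqF.
Qed.

(* The solution of g x.+1 = p g x + q g x.+2, where theta = p/q, with boundary
   values g 0 = 1 and g n = theta ^+ k. *)
Definition profile (R : realType) (theta : R) (n k x : nat) : R :=
  1 + (theta ^+ k - 1) * (theta ^+ x - 1) / (theta ^+ n - 1).

(** With p = theta q and p + q = 1, the equation p + q z^2 = z has the roots 1 and [theta]. This
    makes [profile] harmonic and also gives zero drift at an edge with two particles. *)
Lemma harmonic_base (R : realType) (theta beta : R) :
  1 + beta = theta * (1 - beta) ->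
  (1 + beta) / 2 + (1 - beta) / 2 * theta ^+ 2 = theta.
Proof. by move=> tb; have := congr1 ( *%R theta) tb; rewrite expr2; lra. Qed.

Lemma profile_harmonic (R : realType) (theta beta : R) (n k x : nat) :
  1 + beta = theta * (1 - beta) ->
  (1 + beta) / 2 * profile R theta n k x
    + (1 - beta) / 2 * profile R theta n k x.+2 = profile R theta n k x.+1.
Proof.
move=> /harmonic_base base; rewrite /profile  !exprS.
set c := (theta ^+ n - 1)^-1; set y := theta ^+ x; set d := theta ^+ k - 1.
transitivity
  (1 + d * (((1 + beta) / 2 + (1 - beta) / 2 * theta ^+ 2) * y - 1) * c).
  by field.
by rewrite base.
Qed.

Definition eigenfunction (R : realType) (w : R) (n k : nat)
    (s : {ffun 'I_n -> bool}) : R :=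
  \sum_(i < n.-1) phi R w n i.+1 *
    ((w ^+ 2) ^+ height s i.+1 - profile R (w ^+ 2) n k i.+1).

Lemma eigenfunction_place (R : realType) (w : R) (n k : nat)
    (s : {ffun 'I_n -> bool}) (i : 'I_n.-1) (b : bool) :
  s (edge_left i) != s (edge_right i) ->
  eigenfunction R w n k (place s i b) - eigenfunction R w n k s =
  phi R w n i.+1 *
    ((w ^+ 2) ^+ (height s i + ~~ b) - (w ^+ 2) ^+ height s i.+1).
Proof.
move=> lr; rewrite /eigenfunction -sumrB (bigD1 i)//= big1 => [|j ji].
  by rewrite addr0 height_place_mid; ring.
suff -> : height (place s i b) j.+1 = height s j.+1 by rewrite subrr.
have : (j : nat) != i by [].
rewrite neq_ltn => /orP[ltij|ltij]; first by rewrite height_place_low.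
by rewrite height_place_high//; exact: ltnW (edge_right_subproof j).
Qed.

(** The nonlinearity disappears here. With one particle on the edge, a right placement makes the
    height at [i.+1] equal to that at [i], a left placement to that at [i.+2]. With two or none
    nothing moves, and the bracket vanishes by [harmonic_base] or by p + q = 1. *)
Lemma edge_drift (R : realType) (w beta : R) (n k : nat) (s : config n k)
    (i : 'I_n.-1) :
  1 + beta = w ^+ 2 * (1 - beta) ->
  \sum_(t : config n k) edge_update beta i s t *
    (eigenfunction R w n k (val t) - eigenfunction R w n k (val s)) =
  phi R w n i.+1 * ((1 + beta) / 2 * (w ^+ 2) ^+ height s i
    + (1 - beta) / 2 * (w ^+ 2) ^+ height s i.+2 - (w ^+ 2) ^+ height s i.+1).
Proof.
move=> wb.
rewrite (sum_edge_update _ _ _ _ _ _ (fun u => eigenfunction R w n k u - _)).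
have hS : height s i.+1 = (height s i + s (edge_left i))%N.
  exact: (heightS _ _ (edge_left i)).
rewrite height_edge; case: ifPn => [/eqP lr|lr].
  rewrite subrr hS lr; case: (s (edge_right i)); rewrite ?addn0 ?addn1 ?exprS.
    set z := _ ^+ height s i; set c := phi _ _ _ _.
    transitivity (c * (((1 + beta) / 2 + (1 - beta) / 2 * (w ^+ 2) ^+ 2
      - w ^+ 2) * z)); last by field.
    by rewrite (harmonic_base _ _ _ wb) subrr mul0r mulr0.
  by field.
rewrite !eigenfunction_place// hS.
move: lr; case: (s (edge_left i)); case: (s (edge_right i)) => //= _;
  by rewrite ?addn0 ?addn1 ?exprS; field.
Qed.

(* The jump at edge i is at most (theta - 1) theta^a / theta^((i+1)/2), where
   theta = w^2 and a <= min(i, k) is the height at i. *)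
Lemma edge_variance (R : realType) (w beta : R) (n k : nat) (s : config n k)
    (i : 'I_n.-1) :
  1 <= w -> -1 <= beta <= 1 ->
  \sum_(t : config n k) edge_update beta i s t *
    (eigenfunction R w n k (val t) - eigenfunction R w n k (val s)) ^+ 2 <=
  (w ^+ 2 - 1) ^+ 2 * (w ^+ 2) ^+ k.
Proof.
move=> w1 b1.
rewrite (sum_edge_update _ _ _ _ _ _
  (fun u => (eigenfunction R w n k u - _) ^+ 2)).
have w0 : 0 < w by lra.
have t1 : 1 <= w ^+ 2 by rewrite exprn_ege1.
have t0 : 0 <= w ^+ 2 by exact: sqr_ge0.
have bound_ge0 : 0 <= (w ^+ 2 - 1) ^+ 2 * (w ^+ 2) ^+ k.
  by rewrite mulr_ge0 ?sqr_ge0// exprn_ge0// sqr_ge0.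
case: ifPn => [_|lr]; first by rewrite subrr expr0n.
suff jump b : (eigenfunction R w n k (place s i b) -
    eigenfunction R w n k (val s)) ^+ 2 <= (w ^+ 2 - 1) ^+ 2 * (w ^+ 2) ^+ k.
  by have := jump true; have := jump false; nra.
rewrite eigenfunction_place// (heightS _ _ (edge_left i)).
set a := height s i.
have hi : (a <= i)%N by rewrite height_le// ltnW// (ltn_ord (edge_left i)).
have hk : (a <= k)%N.
  by rewrite -[leqRHS](height_config n k s) height_mono// ltnW//
     (ltn_ord (edge_left i)).
have phi2 : phi R w n i.+1 ^+ 2 * (w ^+ 2) ^+ i.+1 <= 1.
  rewrite /phi expr_div_n exprAC mulfVK ?expf_neq0 ?gt_eqF//.
have dz (c d : bool) : ((w ^+ 2) ^+ (a + c) - (w ^+ 2) ^+ (a + d)) ^+ 2 <=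
    (w ^+ 2 - 1) ^+ 2 * ((w ^+ 2) ^+ a) ^+ 2.
  have := mulr_ge0 (sqr_ge0 (w ^+ 2 - 1)) (sqr_ge0 ((w ^+ 2) ^+ a)).
  by case: c; case: d; rewrite ?addn0 ?addn1 ?exprS; lra.
rewrite exprMn.
apply: (le_trans (ler_wpM2l (sqr_ge0 _) (dz _ _))).
rewrite mulrCA ler_wpM2l ?sqr_ge0//.
(* Of the two factors theta^a, one is absorbed by the decay of [phi] using [a <= i], the other is at
   most theta^k. *)
apply: (@le_trans _ _ (phi R w n i.+1 ^+ 2 *
    ((w ^+ 2) ^+ i.+1 * (w ^+ 2) ^+ k))).
  rewrite ler_wpM2l ?sqr_ge0// [leLHS]expr2.
  by apply: ler_pM; rewrite ?exprn_ge0 ?(ltW w0)// ler_weXn2l// (leq_trans hi).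
by rewrite mulrA ler_piMl// exprn_ge0 ?sqr_ge0.
Qed.

(** The two sides differ by telescoping boundary terms. It transfers the height operator to [phi],
    exchanging p and q, which is the form solved in [phi_eigen]. *)
Lemma summation_by_parts (R : realType) (p q : R) (u y : nat -> R) (m : nat) :
  u 0%N = 0 -> u m.+1 = 0 -> y 0%N = 0 -> y m.+1 = 0 ->
  \sum_(i < m) u i.+1 * (p * y i + q * y i.+2 - y i.+1) =
  \sum_(i < m) (p * u i.+2 + q * u i - u i.+1) * y i.+1.
Proof.
move=> u0 um y0 ym; apply/eqP; rewrite -subr_eq0 -sumrB; apply/eqP.
have tel j : \sum_(i < j) (u i.+1 * (p * y i + q * y i.+2 - y i.+1)
    - (p * u i.+2 + q * u i - u i.+1) * y i.+1) =
    p * (u 1%N * y 0%N - u j.+1 * y j) + q * (u j * y j.+1 - u 0%N * y 1%N).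
  by elim: j => [|j IH]; rewrite ?big_ord0 ?big_ord_recr/= ?IH; ring.
by rewrite tel u0 um y0 ym; ring.
Qed.

Lemma eigenfunction_drift (R : realType) (w r beta : R) (n k : nat)
    (s : config n k) :
  (0 < n)%N -> 1 < w -> 1 + beta = r * w -> r = w * (1 - beta) ->
  \sum_(t : config n k) biased_exclusion beta s t *
    (eigenfunction R w n k (val t) - eigenfunction R w n k (val s)) =
  - ((1 - r * cos (pi / n%:R)) / n.-1%:R) * eigenfunction R w n k (val s).
Proof.
move=> n0 w1 rw wr.
have wb : 1 + beta = w ^+ 2 * (1 - beta) by rewrite rw wr; ring.
rewrite (sum_biased_exclusion _ _ _ _ _ (fun u => eigenfunction R w n k u - _)).
(* Subtracting the harmonic profile leaves the drift unchanged and makes [y] vanish at 0 and [n],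
   where every configuration has heights 0 and [k]. *)
pose y x := (w ^+ 2) ^+ height s x - profile R (w ^+ 2) n k x.
transitivity (n.-1%:R^-1 * \sum_(i < n.-1) phi R w n i.+1 *
    ((1 + beta) / 2 * y i + (1 - beta) / 2 * y i.+2 - y i.+1)).
  congr (_ * _); apply: eq_bigr => i _; rewrite edge_drift// /y.
  by rewrite -(profile_harmonic R (w ^+ 2) beta n k i wb); ring.
rewrite summation_by_parts.
- transitivity (n.-1%:R^-1 *
      ((r * cos (pi / n%:R) - 1) * eigenfunction R w n k (val s))).
    congr (_ * _); rewrite /eigenfunction mulr_sumr; apply: eq_bigr => i _.
    by rewrite (phi_eigen R w r)// -/(y i.+1); [ring|lra].
  by ring.
- exact: phi_0.
- by rewrite prednK// phi_n.
- by rewrite /y height0 /profile expr0 subrr mulr0 mul0r addr0 subrr.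
- rewrite prednK// /y height_config /profile mulfK ?subrr//; first by ring.
  by rewrite subr_eq0 gt_eqF// -exprM exprn_egt1// muln_eq0/= -lt0n.
Qed.

Lemma eigenfunction_variance (R : realType) (w beta : R) (n k : nat)
    (s : config n k) :
  1 <= w -> -1 <= beta <= 1 ->
  \sum_(t : config n k) biased_exclusion beta s t *
    (eigenfunction R w n k (val t) - eigenfunction R w n k (val s)) ^+ 2 <=
  (w ^+ 2 - 1) ^+ 2 * (w ^+ 2) ^+ k.
Proof.
move=> w1 b1.
rewrite (sum_biased_exclusion _ _ _ _ _
  (fun u => (eigenfunction R w n k u - _) ^+ 2)).
apply: (@le_trans _ _ (n.-1%:R^-1 *
    \sum_(i < n.-1) (w ^+ 2 - 1) ^+ 2 * (w ^+ 2) ^+ k)).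
  by rewrite ler_wpM2l// ler_sum// => i _; exact: edge_variance.
rewrite sumr_const card_ord -[(_ * _) *+ _]mulr_natl (mulrA n.-1%:R^-1).
apply: ler_piMl; first by rewrite mulr_ge0 ?sqr_ge0// exprn_ge0 ?sqr_ge0.
(* If there is no edge, the inverse of 0 is 0 and the normalised count is 0 instead of 1. *)
by have [->|?] := eqVneq n.-1 0%N; rewrite ?mulr0// mulVf// pnatr_eq0.
Qed.

(** * The initial configuration packed to the left *)

Lemma height_left (n k x : nat) :
  (x <= n)%N -> height [ffun v : 'I_n => (v < k)%N] x = minn x k.
Proof.
elim: x => [|x IH] xn; first by rewrite height0 min0n.
rewrite (heightS _ _ (Ordinal xn)) IH 1?ltnW// ffunE /=.
have [xk|kx] := ltnP x k.
  by rewrite addn1 (minn_idPl xk).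
by rewrite addn0 (minn_idPr (leqW kx)).
Qed.

Lemma left_config (n k : nat) :
  (k <= n)%N -> exists s : config n k, val s = [ffun v : 'I_n => (v < k)%N].
Proof.
move=> kn.
have card_k : #|[set v | [ffun v : 'I_n => (v < k)%N] v]%SET| == k.
  by rewrite -height_card height_left// (minn_idPr kn).
by exists (Config card_k).
Qed.

(** After clearing the denominator, the factor with exponent min(x, k) is common to both sides, and
    the other follows from max(x, k) <= n. Hence no term of the eigenfunction is negative at the
    packed configuration. *)
Lemma profile_le_left (R : realType) (theta : R) (n k x : nat) :
  1 < theta -> (k <= n)%N -> (x <= n)%N -> (0 < n)%N ->
  profile R theta n k x <= theta ^+ minn x k.
Proof.
move=> t1 kn xn n0.
have pow_le a b : (a <= b)%N -> theta ^+ a <= theta ^+ b.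
  by apply: ler_weXn2l; exact: ltW.
have pow_ge1 a : 1 <= theta ^+ a by rewrite exprn_ege1// ltW.
have tn1 : 0 < theta ^+ n - 1 by rewrite subr_gt0 exprn_egt1// -lt0n.
rewrite /profile -lerBrDl ler_pdivrMr//.
have hx := pow_ge1 x; have hk := pow_ge1 k.
have hxn := pow_le _ _ xn; have hkn := pow_le _ _ kn.
by case: leqP => _; nra.
Qed.

(** The difference factors as (theta^k - 1)(theta^n - theta^x) / (theta^n - 1), and each of the two
    numerator factors loses at most half of its leading power. *)
Lemma profile_right_half (R : realType) (theta : R) (n k x : nat) :
  1 < theta -> 2 <= theta ^+ k -> 2 * theta ^+ x <= theta ^+ n ->
  theta ^+ k / 4 <= theta ^+ k - profile R theta n k x.
Proof.
move=> t1 tk tx.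
have tx1 : 1 <= theta ^+ x by rewrite exprn_ege1// ltW.
have tn1 : 0 < theta ^+ n - 1 by lra.
have -> : theta ^+ k - profile R theta n k x =
    (theta ^+ k - 1) * (theta ^+ n - theta ^+ x) / (theta ^+ n - 1).
  by rewrite /profile; field; rewrite gt_eqF.
rewrite ler_pdivlMr//; nra.
Qed.

(** All terms are nonnegative, so only the [m] sites from [k] on are kept. Each contributes at least
    c w^-(k+m) theta^k / 4, where theta^k = w^(2k). *)
Lemma eigenfunction_left (R : realType) (w c : R) (n k m : nat)
    (s : config n k) :
  val s = [ffun v : 'I_n => (v < k)%N] ->
  1 < w -> (0 < k)%N -> (k + m <= n)%N -> 0 <= c ->
  2 <= (w ^+ 2) ^+ k -> 2 <= (w ^+ 2) ^+ (n - (k + m)) ->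
  (forall x, (k <= x < k + m)%N -> c <= sin (x%:R * (pi / n%:R))) ->
  m%:R * (c / 4 * (w ^+ k / w ^+ m)) <= eigenfunction R w n k (val s).
Proof.
move=> -> w1 k0 kmn c0 tk tn sinc.
have w0 : 0 < w by lra.
have t1 : 1 < w ^+ 2 by rewrite exprn_egt1.
have kn : (k <= n)%N by rewrite (leq_trans _ kmn)// leq_addr.
have n0 : (0 < n)%N by rewrite (leq_trans k0).
pose F x := phi R w n x * ((w ^+ 2) ^+ minn x k - profile R (w ^+ 2) n k x).
have -> : eigenfunction R w n k [ffun v : 'I_n => (v < k)%N] =
    \sum_(1 <= x < n) F x.
  rewrite big_add1 /= big_mkord; apply: eq_bigr => i _.
  by rewrite height_left// (leq_trans (ltn_ord i))// leq_pred.
have F_ge0 x : (x <= n)%N -> 0 <= F x.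
  move=> xn; rewrite mulr_ge0//; last by rewrite subr_ge0 profile_le_left.
  rewrite divr_ge0 ?exprn_ge0 ?(ltW w0)// sin_ge0_pi//.
  rewrite mulr_ge0 ?divr_ge0 ?pi_ge0//= mulrCA ler_piMr ?pi_ge0//.
  by rewrite ler_pdivrMr ?ltr0n// mul1r ler_nat.
have sum_ge0 a b : (b <= n)%N -> 0 <= \sum_(a <= x < b) F x.
  move=> bn; rewrite big_nat_cond sumr_ge0// => x /andP[/andP[_ xb] _].
  by rewrite F_ge0// (leq_trans (ltnW xb)).
rewrite (@big_cat_nat _ _ _ k)//= (@big_cat_nat _ _ _ (k + m) k)//= ?leq_addr//.
rewrite ler_wpDl ?sum_ge0// ler_wpDr ?sum_ge0//.
have -> : m%:R * (c / 4 * (w ^+ k / w ^+ m)) =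
    \sum_(k <= x < k + m) c / 4 * (w ^+ k / w ^+ m).
  by rewrite sumr_const_nat addKn mulr_natl.
apply: ler_sum_nat => x /andP[kx xkm].
rewrite /F (minn_idPr kx).
have half := profile_right_half R (w ^+ 2) n k x t1 tk.
have {}half := half _.
apply: (@le_trans _ _ (c / w ^+ (k + m) * ((w ^+ 2) ^+ k / 4))).
  rewrite le_eqVlt; apply/orP; left; apply/eqP.
  rewrite -exprM mul2n -addnn !exprD; field.
  by rewrite !expf_neq0 ?gt_eqF.
apply: ler_pM; rewrite ?divr_ge0 ?exprn_ge0 ?sqr_ge0 ?(ltW w0)//.
  rewrite /phi ler_pM ?invr_ge0 ?exprn_ge0 ?(ltW w0)//.
    by rewrite sinc// kx.
  rewrite lef_pV2 ?posrE ?exprn_gt0//; apply: ler_weXn2l; first exact: ltW.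
  exact: ltnW.
apply: half; rewrite -(subnK kmn) exprD ler_pM ?exprn_ge0 ?(ltW w0)//.
by apply: ler_weXn2l; [exact: ltW|exact: ltnW].
Qed.

(** * Trigonometric estimates, the gap and the decay inequality *)

Lemma sin_le_id (R : realType) (x : R) : 0 <= x -> sin x <= x.
Proof.
move=> x0; have dsin y : y \in `]0, x[%R -> is_derive y 1 sin (cos y).
  by move=> _; exact: is_derive_sin.
have csin : {within `[0, x], continuous (@sin R)}.
  by apply: continuous_subspaceT; exact: continuous_sin.
have [c _] := MVT_segment x0 dsin csin.
by rewrite sin0 !subr0 => ->; rewrite ler_piMl// cos_le1.
Qed.

Lemma one_sub_cos_le (R : realType) (x : R) :
  0 <= x <= pi -> 1 - cos x <= x ^+ 2 / 2.
Proof.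
move=> /andP[x0 xpi].
have -> : cos x = 1 - 2 * sin (x / 2) ^+ 2.
  by rewrite {1}(_ : x = (x / 2) *+ 2) ?cos_mulr2n ?cos2sin2; [ring|field].
have h1 := sin_le_id R (x / 2) ltac:(lra).
have h2 : 0 <= sin (x / 2) by apply: sin_ge0_pi; lra.
nra.
Qed.

(** The sine increases up to pi/2; past it, x is reflected to pi - x, which is still at least pi/4
    and so at least [a]. *)
Lemma sin_ge_between (R : realType) (a x : R) :
  0 <= a -> a <= pi / 4 -> a <= x -> x <= 3 / 4 * pi -> sin a <= sin x.
Proof.
move=> a0 a4 ax x34; have pi0 := pi_gt0 R.
have mono y : a <= y -> y <= pi / 2 -> sin a <= sin y.
  move=> ay y2; rewrite leNgt ltr_sin ?in_itv/= -?leNgt//.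
    by apply/andP; split; lra.
  by apply/andP; split; lra.
have [xp|xp] := leP x (pi / 2); first exact: mono.
have -> : sin x = sin (pi - x).
  by rewrite sinB sinpi cospi; lra.
by apply: mono; lra.
Qed.

Definition gap (R : realType) (beta : R) (n : nat) : R :=
  (1 - Num.sqrt (1 - beta ^+ 2) * cos (pi / n%:R)) / n.-1%:R.

(** Split 1 - r cos h as (1 - r) + r (1 - cos h): the first part is about beta^2 / 2, the second at
    most h^2 / 2, smaller by a factor of order (n beta)^-2. The two crude bounds control the
    variance ratio and the logarithm of 1 - gap; the sharp one yields the leading constant. *)
Lemma gap_bounds (R : realType) (beta : R) (n : nat) :
  (4 < n)%N -> 0 < beta -> beta <= 1 / 4 ->
  [/\ beta ^+ 2 / (2 * n%:R) <= gap R beta n, gap R beta n <= 2 / n.-1%:R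
    & 2 * (n.-1%:R * gap R beta n) <=
      beta ^+ 2 * (2 / (2 - beta ^+ 2) + pi ^+ 2 * ((n%:R * beta)^-1) ^+ 2)].
Proof.
move=> n4 b0 b4; rewrite /gap.
set r := Num.sqrt _; set h := pi / _; set N : R := n.-1%:R.
have n1 : 4 <= N by rewrite /N (ler_nat R 4) -ltnS prednK// (leq_trans _ n4).
have nE : n%:R = N + 1 by rewrite /N natr1 prednK// (leq_trans _ n4).
have r0 : 0 <= r by exact: sqrtr_ge0.
have r2 : r ^+ 2 = 1 - beta ^+ 2 by rewrite sqr_sqrtr//; nra.
have r1 : r <= 1 by nra.
have rlow : 1 - beta ^+ 2 <= r by nra.
have cos1 := cos_le1 h; have cosN1 := cos_geN1 h.
have pi0 := pi_gt0 R.
have hpi : 0 <= h <= pi.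
  rewrite /h divr_ge0 ?pi_ge0//= ler_pdivrMr ?nE; last by lra.
  by rewrite ler_peMr ?pi_ge0//; lra.
have coslow := one_sub_cos_le R h hpi.
split.
- rewrite ler_pdivlMr; last by lra.
  apply: (@le_trans _ _ (beta ^+ 2 / 2)); last by nra.
  have -> : beta ^+ 2 / (2 * n%:R) * N = beta ^+ 2 / 2 * (N / (N + 1)).
    by rewrite nE; field; lra.
  by rewrite ler_piMr ?divr_ge0 ?sqr_ge0// ler_pdivrMr; lra.
- by rewrite ler_pM2r ?invr_gt0; nra.
have -> : N * ((1 - r * cos h) / N) = 1 - r * cos h by field; lra.
(* 1 - r = beta^2 / (1 + r), and [rlow] bounds 1 + r below by 2 - beta^2. *)
have onemr : 1 - r <= beta ^+ 2 / (2 - beta ^+ 2).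
  rewrite ler_pdivlMr; last by nra.
  by nra.
have -> : beta ^+ 2 * (2 / (2 - beta ^+ 2) + pi ^+ 2 * (n%:R * beta)^-1 ^+ 2) =
    2 * (beta ^+ 2 / (2 - beta ^+ 2)) + h ^+ 2.
  rewrite /h nE; field; apply/and3P; split; nra.
nra.
Qed.

(* In the application m is the integer part of 1/beta: the m sites next to the
   edge of the packed block carry the initial value of the eigenfunction. *)
Lemma mixing_decay (R : realType) (beta c eps : R) (n k m t : nat)
    (mu : config n k -> R) :
  (4 < n)%N -> (0 < k)%N -> (k + m <= n)%N ->
  0 < beta -> beta <= 1 / 4 -> 0 < c -> eps < 1 ->
  m%:R * beta <= 1 -> 1 <= 2 * (m%:R * beta) ->
  1 <= 2 * (k%:R * beta) -> 1 <= 2 * ((n - (k + m))%:R * beta) ->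
  (forall x, (k <= x < k + m)%N -> c <= sin (x%:R * (pi / n%:R))) ->
  is_stationary (@biased_exclusion R beta n k) mu ->
  max_tv_dist (@biased_exclusion R beta n k) mu t < eps ->
  (1 - eps) * c ^+ 2 * ((1 - gap R beta n) ^+ t) ^+ 2 <=
    2 ^+ 13 * expR 4 * (n%:R * beta ^+ 2).
Proof.
move=> n4 k0 kmn b0 b4 c0 eps1 mb mb2 kb nb sinc stat tv.
have [gap_ge gap_le _] := gap_bounds R beta n n4 b0 b4.
pose r := Num.sqrt (1 - beta ^+ 2); pose w := (1 + beta) / r.
have r0 : 0 < r by rewrite sqrtr_gt0; nra.
have r2 : r ^+ 2 = 1 - beta ^+ 2 by rewrite sqr_sqrtr//; nra.
have rw : 1 + beta = r * w by rewrite /w; field; lra.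
have wr : r = w * (1 - beta).
  by apply: (mulfI (lt0r_neq0 r0)); rewrite mulrA -rw -expr2 r2; ring.
have theta_eq : w ^+ 2 * (1 - beta) = 1 + beta.
  by rewrite rw expr2 -mulrA -wr mulrC.
have w0 : 0 < w by rewrite divr_gt0//; lra.
have theta_ge : 1 + 2 * beta <= w ^+ 2 by nra.
have theta_le : w ^+ 2 <= 1 + 4 * beta by nra.
have w1 : 1 < w by nra.
(* By Bernoulli's inequality, 1/(2 beta) sites suffice to double the power of theta. *)
have bernoulli j : 1 <= 2 * (j%:R * beta) -> 2 <= (w ^+ 2) ^+ j.
  move=> jb; apply: (@le_trans _ _ ((1 + 2 * beta) ^+ j)).
    have : 1 + 2 * (j%:R * beta) <= (1 + 2 * beta) ^+ j.
      elim: j {jb} => [|j IH]; first by rewrite mul0r mulr0 addr0.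
      rewrite exprS -natr1; have := ler0n R j; nra.
    lra.
  by apply: lerXn2r; rewrite ?nnegrE; lra.
have [s sE] := left_config n k (leq_trans (leq_addr m k) kmn).
have Phi_ge := eigenfunction_left R w c n k m s sE w1 k0 kmn (ltW c0)
  (bernoulli _ kb) (bernoulli _ nb) sinc.
set Phi := eigenfunction _ _ _ _ _ in Phi_ge.
have m0 : 0 < m%:R :> R by nra.
have Phi_low_gt0 : 0 < m%:R * (c / 4 * (w ^+ k / w ^+ m)).
  by rewrite !mulr_gt0 ?invr_gt0 ?exprn_gt0//; lra.
have n0 : 0 < n%:R :> R by rewrite ltr0n (leq_trans _ n4).
have gap0 : 0 < gap R beta n.
  by apply: lt_le_trans gap_ge; rewrite divr_gt0 ?exprn_gt0//; lra.
have gap2 : gap R beta n <= 1 / 2.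
  apply: (le_trans gap_le).
  rewrite ler_pdivrMr ?ltr0n ?ltn_predRL ?(ltn_trans _ n4)//.
  suff : 4 <= n.-1%:R :> R by lra.
  by rewrite (ler_nat R 4) -ltnS prednK// (leq_trans _ n4).
have n1 : (0 < n)%N by exact: leq_trans n4.
have := @wilson R _ (@biased_exclusion R beta n k) mu
  (fun u => eigenfunction R w n k (val u)) (gap R beta n)
  ((w ^+ 2 - 1) ^+ 2 * (w ^+ 2) ^+ k) eps s t _ stat _ _ gap0 gap2 _ tv.
set q := (1 - gap R beta n) ^+ t; rewrite -/Phi => wils.
have q0 : 0 <= q by rewrite exprn_ge0//; lra.
have {}wils : (1 - eps) * (q * Phi) ^+ 2 <=
    4 * ((w ^+ 2 - 1) ^+ 2 * (w ^+ 2) ^+ k) / gap R beta n.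
  apply: wils.
  - move=> y; apply: biased_exclusion_distribution; last by lra.
    exact: leq_trans n4.
  - by move=> y; rewrite (eigenfunction_drift R w r).
  - by move=> y; apply: eigenfunction_variance; lra.
  - by apply: lt_le_trans Phi_ge.
set T := (w ^+ 2) ^+ k in wils *.
have T0 : 0 < T by rewrite !exprn_gt0.
(* theta - 1 <= 4 beta, and beta^2 <= 2 n gap, whence 16 beta^2 <= 32 n gap. *)
have rhs : 4 * ((w ^+ 2 - 1) ^+ 2 * T) / gap R beta n <= 128 * n%:R * T.
  have jump : (w ^+ 2 - 1) ^+ 2 <= 32 * (n%:R * gap R beta n).
    by move: gap_ge; rewrite ler_pdivrMr; [nra|lra].
  rewrite ler_pdivrMr// (_ : 128 * _ * _ * _ =
    4 * (32 * (n%:R * gap R beta n) * T)); last by ring.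
  by rewrite ler_pM2l// ler_pM2r.
have Wm : (w ^+ m) ^+ 2 <= expR 4.
  rewrite exprAC; apply: (@le_trans _ _ (expR (4 * beta) ^+ m)).
    apply: lerXn2r; rewrite ?nnegrE ?expR_ge0 ?sqr_ge0//.
    by apply: le_trans (expR_ge1Dx _).
  by rewrite -expRM_natl ler_expR; lra.
have Phi2 : m%:R ^+ 2 * c ^+ 2 * T <= 16 * expR 4 * Phi ^+ 2.
  apply: (@le_trans _ _ (16 * (w ^+ m) ^+ 2 * Phi ^+ 2)); last first.
    by rewrite ler_wpM2r ?sqr_ge0// ler_pM2l.
  have -> : m%:R ^+ 2 * c ^+ 2 * T = 16 * (w ^+ m) ^+ 2 *
      (m%:R * (c / 4 * (w ^+ k / w ^+ m))) ^+ 2.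
    rewrite /T exprAC; field.
    by rewrite gt_eqF ?exprn_gt0.
  apply: ler_wpM2l; first by rewrite mulr_ge0 ?sqr_ge0.
  by apply: lerXn2r; rewrite ?nnegrE// ltW// (lt_le_trans Phi_low_gt0).
have mb3 : 1 <= 4 * (m%:R ^+ 2 * beta ^+ 2) by nra.
(* The factor theta^k occurs in both the variance and the squared initial value and cancels. Here
   2048 = 128 * 16; the factor 4 of [mb3] then gives 2^13. *)
have wT : (1 - eps) * q ^+ 2 * m%:R ^+ 2 * c ^+ 2 <= 2048 * expR 4 * n%:R.
  rewrite -(ler_pM2r T0).
  have q2 : 0 <= (1 - eps) * q ^+ 2 by rewrite mulr_ge0 ?sqr_ge0//; lra.
  have := ler_wpM2l q2 Phi2.
  have e4 : 0 <= expR 4 :> R by exact: expR_ge0.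
  have := ler_wpM2l e4 (le_trans wils rhs).
  lra.
have q2 : 0 <= (1 - eps) * c ^+ 2 * q ^+ 2.
  apply: mulr_ge0; last exact: sqr_ge0.
  by apply: mulr_ge0; [lra|exact: sqr_ge0].
have := ler_wpM2l q2 mb3.
have := ler_wpM2r (sqr_ge0 beta) wT.
lra.
Qed.

(** * From exponential decay to a bound on time *)

(** ln L = 2 ln(sqrt L) <= 2 sqrt L. With L = ln n this makes the correction ln(n beta) negligible
    against ln n. *)
Lemma ln_le_sqrt (R : realType) (y L : R) :
  0 < y -> y <= L -> ln y <= 2 * Num.sqrt L.
Proof.
move=> y0 yL; have L0 : 0 < L by exact: lt_le_trans yL.
have sL : 0 < Num.sqrt L by rewrite sqrtr_gt0.
apply: (@le_trans _ _ (ln L)); first by rewrite ler_ln ?posrE.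
have -> : ln L = 2 * ln (Num.sqrt L).
  by rewrite mulr_natl -lnXn// sqr_sqrtr// ltW.
rewrite ler_pM2l//.
exact/ltW/ln_sublinear.
Qed.

(** Take logarithms, writing n beta^2 as (n beta)^2 / n: this produces ln n, and 2 ln(n beta) costs
    at most 4 sqrt(ln n). With N = n - 1, the bound g <= 2/N gives -ln(1 - g) <= g / (1 - g) <= N g
    / (N - 2), which accounts for the factor n - 3. *)
Lemma decay_time (R : realType) (beta K c g : R) (n t : nat) :
  (4 < n)%N -> 0 < beta -> 0 < g -> g <= 2 / n.-1%:R -> 0 < c -> 0 < K ->
  c * ((1 - g) ^+ t) ^+ 2 <= K * (n%:R * beta ^+ 2) ->
  n%:R * beta <= ln n%:R ->
  (n%:R - 3) * (ln n%:R - 4 * Num.sqrt (ln n%:R) - (ln K - ln c)) <=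
    t%:R * (2 * (n.-1%:R * g)).
Proof.
move=> n4 b0 g0; set N : R := n.-1%:R.
have n1 : 4 <= N by rewrite /N (ler_nat R 4) -ltnS prednK// (leq_trans _ n4).
have nE : n%:R = N + 1 by rewrite /N natr1 prednK// (leq_trans _ n4).
rewrite ler_pdivlMr; last by lra.
move=> gN c0 K0 decay nbL.
have n0 : 0 < n%:R :> R by rewrite nE; lra.
have g1 : 0 < 1 - g by nra.
have nb0 : 0 < n%:R * beta by rewrite mulr_gt0.
have lnb := ln_le_sqrt R _ _ nb0 nbL.
have log_decay : ln c + 2 * (t%:R * ln (1 - g)) <=
    ln K + 2 * ln (n%:R * beta) - ln n%:R.
  have lhsE : ln (c * ((1 - g) ^+ t) ^+ 2) = ln c + 2 * (t%:R * ln (1 - g)).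
    rewrite lnM ?posrE ?exprn_gt0// lnXn ?exprn_gt0// lnXn//.
    by rewrite !mulr_natl.
  have rhsE : ln (K * (n%:R * beta ^+ 2)) =
      ln K + 2 * ln (n%:R * beta) - ln n%:R.
    have b2 : 0 < beta ^+ 2 by rewrite exprn_gt0.
    rewrite (@lnM _ K) ?posrE ?mulr_gt0// !(@lnM _ n%:R) ?posrE// lnXn//.
    by ring.
  by rewrite -lhsE -rhsE ler_ln ?posrE ?mulr_gt0 ?exprn_gt0.
have log_g : (N - 2) * - ln (1 - g) <= N * g.
  have lng : - ln (1 - g) <= g / (1 - g).
    rewrite -lnV ?posrE// [X in ln X](_ : _ = 1 + g / (1 - g)).
      by rewrite le_ln1Dx// (@lt_trans _ _ 0) ?ltrN10// divr_gt0.
    by field; lra.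
  apply: (@le_trans _ _ ((N - 2) * (g / (1 - g)))).
    by rewrite ler_wpM2l//; lra.
  by rewrite mulrA ler_pdivrMr//; nra.
have -> : n%:R - 3 = N - 2 by rewrite nE; ring.
apply: (@le_trans _ _ ((N - 2) * (2 * (t%:R * - ln (1 - g))))).
  by rewrite ler_wpM2l; lra.
have := ler_wpM2l (ler0n R t) log_g; lra.
Qed.

(** * Limits and the relative error *)

Lemma cvgy_sqrt (R : realType) (u : nat -> R) :
  u n @[n --> \oo] --> +oo -> Num.sqrt (u n) @[n --> \oo] --> +oo.
Proof.
move=> /cvgryPge uy; apply/cvgryPge => a.
apply: filterS (uy (a ^+ 2)) => n an.
by rewrite (le_trans (ler_norm a))// -sqrtr_sqr ler_wsqrtr.
Qed.

Lemma cvgy_inv (R : realType) (u : nat -> R) :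
  u n @[n --> \oo] --> +oo -> (u n)^-1 @[n --> \oo] --> (0 : R).
Proof.
move=> uy; apply/gtr0_cvgV0 => //.
by move/cvgryPgt : uy; apply.
Qed.

Lemma ln_nat_cvgy (R : realType) : ln (n%:R : R) @[n --> \oo] --> +oo.
Proof.
apply/cvgryPge => a.
have /cvgryPge/(_ (expR a)) := @cvgr_idn R.
apply: filterS => n an; rewrite -[a]expRK ler_ln ?posrE ?expR_gt0//.
exact: lt_le_trans (expR_gt0 a) an.
Qed.

(** Since n beta <= ln n <= 2 sqrt n, the bias is at most 2 / sqrt n. *)
Lemma bias_cvg0 (R : realType) (beta : nat -> R) :
  (\forall n \near \oo, 0 < beta n) ->
  (\forall n \near \oo, n%:R * beta n <= ln n%:R) ->
  beta n @[n --> \oo] --> (0 : R).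
Proof.
move=> hbeta hlog.
have up : 2 * (Num.sqrt (n%:R : R))^-1 @[n --> \oo] --> (0 : R).
  rewrite -[X in _ --> X](mulr0 (2 : R)); apply: cvgM; first exact: cvg_cst.
  by apply: cvgy_inv; apply: cvgy_sqrt; exact: cvgr_idn.
apply: (squeeze_cvgr _ _ up); last exact: (cvg_cst 0).
near=> n.
have n0 : 0 < n%:R :> R by rewrite ltr0n; near: n; exact: nbhs_infty_gt.
have b0 : 0 < beta n by near: n.
have nb : n%:R * beta n <= ln n%:R by near: n.
have s0 : 0 < Num.sqrt (n%:R : R) by rewrite sqrtr_gt0.
rewrite (ltW b0) /= ler_pdivlMr//.
have := le_trans nb (ln_le_sqrt R _ _ n0 (lexx _)).
rewrite -{1}(sqr_sqrtr (ltW n0)) expr2 -mulrA mulrC.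
by rewrite ler_pM2r// mulrC.
Unshelve. all: by end_near. Qed.

(* Written in terms of v = (ln n)^(-1/2), so that convergence to 0 follows
   from the limit theorems; it uses ln (n beta) <= 2 / v. *)
Definition relative_error (R : realType) (beta : nat -> R) (K c : R) (n : nat)
    : R :=
  let v := (Num.sqrt (ln n%:R))^-1 in
  (1 - 3 * n%:R^-1) /
  (2 / (2 - beta n ^+ 2) + pi ^+ 2 * ((n%:R * beta n)^-1) ^+ 2)
  * ((1 - 4 * v - K * v ^+ 2) / (1 + c * v ^+ 2)) - 1.

Lemma relative_error_cvg0 (R : realType) (beta : nat -> R) (K c : R) :
  beta n @[n --> \oo] --> (0 : R) -> n%:R * beta n @[n --> \oo] --> +oo ->
  relative_error R beta K c n @[n --> \oo] --> (0 : R).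
Proof.
move=> b0 nb.
have v0 : (Num.sqrt (ln (n%:R : R)))^-1 @[n --> \oo] --> (0 : R).
  by apply: cvgy_inv; apply: cvgy_sqrt; exact: ln_nat_cvgy.
have n0 : (n%:R : R)^-1 @[n --> \oo] --> (0 : R).
  by apply: cvgy_inv; exact: cvgr_idn.
have y0 := cvgy_inv R _ nb.
have sq u : u n @[n --> \oo] --> (0 : R) -> u n ^+ 2 @[n --> \oo] --> (0 : R).
  by move=> u0; rewrite -[X in _ --> X](mulr0 0); apply: cvgM.
have cst (a : R) : (fun=> a) n @[n --> \oo] --> a by exact: cvg_cst.
have scale a u : u n @[n --> \oo] --> (0 : R) ->
    a * u n @[n --> \oo] --> (0 : R).
  by move=> u0; rewrite -[X in _ --> X](mulr0 a); apply: cvgM.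
(* The limit is written in the shape of the expression, so that the limit rules apply factor by
   factor. *)
rewrite [X in _ --> X](_ : 0 = (1 - 0) / (2 / (2 - 0) + 0)
  * ((1 - 0 - 0) / (1 + 0)) - 1 :> R); last by field.
apply: cvgB; last exact: cst.
apply: cvgM; apply: cvgM.
- by apply: cvgB => //; apply: scale.
- apply: cvgV; first by rewrite gt_eqF// addr0 subr0 divr_gt0.
  apply: cvgD; last by apply: scale; apply: sq.
  apply: cvgM => //; apply: cvgV; first by rewrite subr0.
  by apply: cvgB => //; apply: sq.
- apply: cvgB; last by apply: scale; apply: sq.
  by apply: cvgB => //; apply: scale.
- apply: cvgV; first by rewrite addr0.
  by apply: cvgD => //; apply: scale; apply: sq.
Qed.

(** [relative_error] solves for delta the equation between the claimed bound and the time bound of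
    [decay_time]: [q] stands for sqrt(ln n), [c] for ln((1 - eps) / eps), [a] for the ratio bounding
    2 (n - 1) gap / beta^2. *)
Lemma relative_error_mul (R : realType) (N b a q c K : R) :
  N != 0 -> b != 0 -> a != 0 -> q != 0 -> q ^+ 2 + c != 0 ->
  N / b ^+ 2 * (1 + ((1 - 3 * N^-1) / a *
    ((1 - 4 * q^-1 - K * q^-1 ^+ 2) / (1 + c * q^-1 ^+ 2)) - 1)) * (q ^+ 2 + c)
  = (N - 3) * (q ^+ 2 - 4 * q - K) / (b ^+ 2 * a).
Proof. by move=> N0 b0 a0 q0 qc; field; rewrite N0 b0 a0 q0 qc. Qed.

(** * The mixing time at fixed size and the asymptotic bound *)

Lemma mixing_time_ge (R : realType) (T : finType) (P : T -> T -> R)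
    (mu : T -> R) (eps b : R) :
  (forall t, max_tv_dist P mu t < eps -> b <= t%:R) ->
  (b%:E <= mixing_time P mu eps)%E.
Proof.
move=> H; rewrite /mixing_time; case: pselect => [ex|_]; last exact: leey.
by rewrite lee_fin; apply: H; case: ex_minnP.
Qed.

Lemma mixing_time_explicit (R : realType) (beta rho eps : R) (n k t : nat)
    (mu : config n k -> R) (s := sin (rho / 2 * pi))
    (C := (1 - eps) * s ^+ 2) (K := ln (2 ^+ 13 * expR 4) - ln C) :
  (4 < n)%N -> 0 < beta -> beta <= 1 / 4 -> 0 < rho -> rho <= 1 / 2 ->
  eps < 1 -> rho / 2 * n%:R <= k%:R -> k%:R <= 5 / 8 * n%:R :> R ->
  8 <= n%:R * beta -> 1 <= rho * (n%:R * beta) -> n%:R * beta <= ln n%:R ->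
  is_stationary (@biased_exclusion R beta n k) mu ->
  max_tv_dist (@biased_exclusion R beta n k) mu t < eps ->
  (n%:R - 3) * (ln n%:R - 4 * Num.sqrt (ln n%:R) - K) <=
    t%:R * (beta ^+ 2 *
      (2 / (2 - beta ^+ 2) + pi ^+ 2 * ((n%:R * beta)^-1) ^+ 2)).
Proof.
rewrite {}/K {}/C {}/s.
move=> n4 b0 b4 rho0 rho2 eps1 kge kle nb8 rnb nbL stat tv.
have pi0 := pi_gt0 R.
have n0 : 0 < n%:R :> R by rewrite ltr0n (leq_trans _ n4).
have [s sE] : exists s, s = sin (rho / 2 * pi) by exists (sin (rho / 2 * pi)).
rewrite -sE.
have s0 : 0 < s by rewrite sE; apply: sin_gt0_pi; nra.
have C0 : 0 < (1 - eps) * s ^+ 2 by rewrite mulr_gt0 ?exprn_gt0//; lra.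
have ib0 : 0 <= beta^-1 by rewrite invr_ge0 ltW.
(* [m] is the integer part of 1/beta, so m beta lies in (1 - beta, 1] and is at least 1/2. *)
have [m /andP[mle mgt]] : exists m : nat, m%:R <= beta^-1 < m.+1%:R.
  by exists (Num.trunc beta^-1); exact: truncn_itv.
have mb : m%:R * beta <= 1 by rewrite -ler_pdivlMr// div1r.
have mb2 : 1 <= 2 * (m%:R * beta).
  have : 1 < (m%:R + 1) * beta by rewrite natr1 -ltr_pdivrMr// div1r.
  by lra.
have mn : m%:R <= n%:R / 8 :> R.
  by rewrite -(ler_pM2r b0) (le_trans mb)//; lra.
(* 5/8 + 1/8 = 3/4: a quarter of the path stays free to the right, and the window avoids the zero of
   the sine at pi. *)
have kmR : (k + m)%:R <= 3 / 4 * n%:R :> R by rewrite natrD; lra.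
have kmn : (k + m <= n)%N by rewrite -(ler_nat R); lra.
have k0 : (0 < k)%N by rewrite -(ltr0n R) (lt_le_trans _ kge)// mulr_gt0//; lra.
have kb : 1 <= 2 * (k%:R * beta).
  by have := ler_wpM2r (ltW b0) kge; lra.
have nkb : 1 <= 2 * ((n - (k + m))%:R * beta).
  by rewrite natrB//; have := ler_wpM2r (ltW b0) kmR; lra.
have sinc x : (k <= x < k + m)%N -> s <= sin (x%:R * (pi / n%:R)).
  move=> /andP[kx xkm]; have xE : x%:R * (pi / n%:R) = x%:R / n%:R * pi :> R.
    by rewrite mulrA mulrAC.
  have {}kx : rho / 2 <= x%:R / n%:R.
    by rewrite ler_pdivlMr// (le_trans kge)// ler_nat.
  have {}xkm : x%:R / n%:R <= 3 / 4 :> R.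
    by rewrite ler_pdivrMr// (le_trans _ kmR)// ler_nat ltnW.
  rewrite xE sE; apply: sin_ge_between.
  - by rewrite mulr_ge0 ?divr_ge0// ltW.
  - by rewrite [leRHS]mulrC ler_pM2r//; lra.
  - by rewrite ler_pM2r.
  - by rewrite ler_pM2r.
have decay := mixing_decay R beta s eps n k m t mu n4 k0 kmn b0 b4
  s0 eps1 mb mb2 kb nkb sinc stat tv.
have [gap_ge gap_le gap_sharp] := gap_bounds R beta n n4 b0 b4.
have gap0 : 0 < gap R beta n.
  by apply: lt_le_trans gap_ge; rewrite divr_gt0 ?exprn_gt0// mulr_gt0.
have K0 : 0 < 2 ^+ 13 * expR 4 :> R by rewrite mulr_gt0 ?exprn_gt0 ?expR_gt0.
have time := decay_time R beta _ _ _ n t n4 b0 gap0 gap_le C0 K0 decay nbL.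
exact: le_trans time (ler_wpM2l (ler0n R t) gap_sharp).
Qed.

Theorem proposition7 (R : realType) (beta : nat -> R) (k : nat -> nat) (rho : R)
    (mu : forall n : nat, config n (k n) -> R)
    (hbeta : \forall n \near \oo, 0 < beta n)
    (hrho : 0 < rho <= 1 / 2)
    (hk : (k n)%:R / n%:R @[n --> \oo] --> rho)
    (hmu : \forall n \near \oo,
       is_stationary (@biased_exclusion R (beta n) n (k n)) (mu n))
    (hinf : n%:R * beta n @[n --> \oo] --> +oo)
    (hlog : \forall n \near \oo, n%:R * beta n <= ln n%:R)
    (eps : R) (heps : 0 < eps < 1) :
  exists delta : nat -> R,
    delta n @[n --> \oo] --> (0 : R) /\
    \forall n \near \oo,
      ((n%:R / beta n ^+ 2 * (1 + delta n)
         * (ln n%:R + ln ((1 - eps) / eps)))%:E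
       <= mixing_time (@biased_exclusion R (beta n) n (k n)) (mu n) eps)%E.
Proof.
have [/andP[rho0 rho2] /andP[eps0 eps1]] := (hrho, heps).
have beta0 := bias_cvg0 R beta hbeta hlog.
pose s := sin (rho / 2 * pi).
pose C := (1 - eps) * s ^+ 2.
pose K := ln (2 ^+ 13 * expR 4) - ln C.
exists (relative_error R beta K (ln ((1 - eps) / eps))).
split; first exact: relative_error_cvg0.
set c := ln _.
near=> n; apply: mixing_time_ge => t tv.
have n4 : (4 < n)%N by near: n; exact: nbhs_infty_gt.
have b0 : 0 < beta n by near: n.
have b4 : beta n <= 1 / 4 by near: n; apply: (cvgr_le _ beta0); lra.
have stat : is_stationary (@biased_exclusion R (beta n) n (k n)) (mu n).
  by near: n.
(* The threshold 8 gives m <= n/8; 1/rho makes k beta at least 1/2. *)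
have nb8 : 8 <= n%:R * beta n by near: n; exact: (cvgryPge _).1 hinf _.
have nbrho : rho^-1 <= n%:R * beta n by near: n; exact: (cvgryPge _).1 hinf _.
have nbL : n%:R * beta n <= ln n%:R by near: n.
have L0 : 0 < ln n%:R :> R by apply: lt_le_trans nbL; lra.
(* Keeps ln n + c positive, since c may be negative and is divided by within [relative_error]. *)
have Lc : 1 - c <= ln n%:R :> R.
  by near: n; exact: (cvgryPge _).1 (ln_nat_cvgy R) _.
have n0 : 0 < n%:R :> R by rewrite ltr0n (leq_trans _ n4).
have kge : rho / 2 * n%:R <= (k n)%:R.
  rewrite -ler_pdivlMr//; near: n; apply: (cvgr_ge _ hk); lra.
have kle : (k n)%:R <= 5 / 8 * n%:R :> R.
  have : (k n)%:R / n%:R <= 5 / 8 :> R; last by rewrite ler_pdivrMr.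
  near: n; apply: (cvgr_le _ hk); lra.
have rnb : 1 <= rho * (n%:R * beta n).
  by move: nbrho; rewrite -div1r ler_pdivrMr// mulrC.
have time := mixing_time_explicit R (beta n) rho eps n (k n) t (mu n) n4 b0 b4
  rho0 rho2 eps1 kge kle nb8 rnb nbL stat tv.
rewrite -/s -/C -/K in time.
set a := 2 / _ + _ in time.
have a0 : 0 < a.
  apply: ltr_wpDr; first by rewrite mulr_ge0 ?sqr_ge0.
  by rewrite divr_gt0// subr_gt0 expr2; nra.
have q0 : 0 < Num.sqrt (ln (n%:R : R)) by rewrite sqrtr_gt0.
have q2 : Num.sqrt (ln (n%:R : R)) ^+ 2 = ln n%:R by rewrite sqr_sqrtr// ltW.
rewrite /relative_error -/a /=; set q := Num.sqrt _ in time q0 q2 *.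
rewrite -q2; rewrite -q2 in time Lc.
rewrite relative_error_mul ?gt_eqF//; last by lra.
by rewrite ler_pdivrMr// mulr_gt0// exprn_gt0.
Unshelve. all: by end_near. Qed.
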